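(* Let $M$ be a linear maximal monotone operator on a real Hilbert space. Then, for any memory $m$ (including $m=\infty$) and any $y_0$, the residual sequence of AA($m$) applied to the proximal point method is nonincreasing: $\|r_{k+1}\|\le\|r_k\|$ for all $k$.
   Context: $J=(I+M)^{-1}$. AA($m$) for the proximal point method: from $y_0$, with $x_k=J(y_k)$, $r_k=x_k-y_k$, set $y_1=x_0$ and at iteration $k\ge1$ with window $\mu=\min(m,k)$ choose $\gamma^k\in\arg\min\{\|\sum_{i=0}^{\mu}\gamma_ir_{k-\mu+i}\|^2:\gamma\in\mathbb{R}^{\mu+1},\ \sum_i\gamma_i=1\}$ and set $y_{k+1}=\sum_{i=0}^{\mu}\gamma^k_ix_{k-\mu+i}$. *)

(* Defs.v *)
From HB Require Import structures.
From mathcomp Require Import all_boot all_order all_algebra.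
From mathcomp Require Import all_classical all_reals all_analysis.

Set Implicit Arguments.
Unset Strict Implicit.
Unset Printing Implicit Defensive.

Import Order.TTheory GRing.Theory Num.Theory.
Import numFieldNormedType.Exports.

Local Open Scope classical_set_scope.
Local Open Scope ring_scope.

(* A real Hilbert space is a complete normed module [H] over a [realType]
   together with an inner product [ip] (positive definite symmetric bilinear
   form) that induces its norm. *)
Definition induces_norm (R : realType) (H : completeNormedModType R)
    (ip : {dot H for (@idfun R)}) : Prop :=
  forall u : H, `|u| ^+ 2 = ip u u.

Section Operators.
Variables (R : realType) (H : completeNormedModType R).

(* Operators on [H] are set-valued: [M x u] means that u belongs to M x. A
   possibly unbounded single-valued operator is the special case in which every
   [M x] has at most one element. *)
Implicit Types M N : H -> set H.

(* The graph is a linear subspace of H x H. *)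
Definition linear_operator M : Prop :=
  M 0 0 /\
  forall (a : R) (x y u v : H), M x u -> M y v -> M (a *: x + y) (a *: u + v).

Definition monotone_operator (ip : {dot H for (@idfun R)}) M : Prop :=
  forall x y u v : H, M x u -> M y v -> 0 <= ip (x - y) (u - v).

Definition maximal_monotone (ip : {dot H for (@idfun R)}) M : Prop :=
  monotone_operator ip M /\
  forall N, monotone_operator ip N ->
    (forall x, M x `<=` N x) -> forall x, N x `<=` M x.

Definition id_plus M : H -> set H := fun x => [set x + u | u in M x].

Definition inverse_operator M : H -> set H := fun y => [set x | M x y].

Definition resolvent M : H -> set H := inverse_operator (id_plus M).

End Operators.

Section AndersonAcceleration.
Variables (R : realType) (H : completeNormedModType R).

(* The memory m is [Some m] when finite and [None] when infinite. *)
Definition window (m : option nat) (k : nat) : nat :=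
  if m is Some m' then minn m' k else k.

Definition window_comb (z : nat -> H) (mu k : nat) (gamma : 'rV[R]_mu.+1) : H :=
  \sum_(i < mu.+1) gamma 0 i *: z (k - mu + i)%N.

Definition affine_weights (n : nat) (gamma : 'rV[R]_n) : Prop :=
  \sum_(i < n) gamma 0 i = 1.

Definition AA_argmin (r : nat -> H) (mu k : nat) (gamma : 'rV[R]_mu.+1) : Prop :=
  affine_weights gamma /\
  forall delta : 'rV[R]_mu.+1, affine_weights delta ->
    `|window_comb r k gamma| ^+ 2 <= `|window_comb r k delta| ^+ 2.

(* The minimizing weights need not be unique, so AA(m) is specified as a
   relation: [AA_run M m y0 x y r] holds for the sequences produced by any
   choice of minimizers. *)
Record AA_run (M : H -> set H) (m : option nat) (y0 : H)
    (x y r : nat -> H) : Prop := {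
  AA_start : y 0%N = y0;
  AA_prox : forall k, resolvent M (y k) (x k);
  AA_residual : forall k, r k = x k - y k;
  AA_first : y 1%N = x 0%N;
  AA_step : forall k, (1 <= k)%N ->
    exists2 gamma : 'rV[R]_(window m k).+1,
      AA_argmin r k gamma & y k.+1 = window_comb x k gamma
}.

End AndersonAcceleration.

(* Main.v *)
(* The resolvent J of a linear M is linear, so
   [J (sum gamma_i y_i) = sum gamma_i x_i].  With ybar and xbar the two
   combinations, [y_(k+1) = xbar = J ybar], so
   [r_(k+1) = J xbar - J ybar], and J is nonexpansive:
   [|r_(k+1)| <= |xbar - ybar|].  The right-hand side is the minimal norm over
   the window, at most [|r_k|] since the unit weight on [r_k] is admissible. *)
Require Import Defs.
From HB Require Import structures.
From mathcomp Require Import all_boot all_order all_algebra.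
From mathcomp Require Import lra.
From mathcomp Require Import all_classical all_reals all_analysis.

Set Implicit Arguments.
Unset Strict Implicit.
Unset Printing Implicit Defensive.

Import Order.TTheory GRing.Theory Num.Theory.
Import numFieldNormedType.Exports.

Local Open Scope classical_set_scope.
Local Open Scope ring_scope.

Lemma linear_operator_sum (R : realType) (H : completeNormedModType R)
    (M : H -> set H) (n : nat) (c : 'I_n -> R) (x u : 'I_n -> H) :
  linear_operator M -> (forall i, M (x i) (u i)) ->
  M (\sum_i c i *: x i) (\sum_i c i *: u i).
Proof.
move=> [M0 Mlin] Mxu.
(* [M] serves as the relation carried along both sums: [M 0 0] covers the empty sum, coefficient 1
   gives additivity, and adding 0 gives scaling. *)
by elim/big_ind2 : _ => [//|a b a' b' Ma Mb|i _];
  [rewrite -[a]scale1r -[b]scale1r; exact: Mlin |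
   rewrite -[c i *: x i]addr0 -[c i *: u i]addr0; exact: Mlin].
Qed.

Lemma resolventP (R : realType) (H : completeNormedModType R)
    (M : H -> set H) (y x : H) : resolvent M y x <-> M x (y - x).
Proof.
split; first by move=> [u Mxu <-]; rewrite addrC addKr.
by move=> Mxyx; exists (y - x); rewrite // addrC subrK.
Qed.

(** Expanding [0 <= |b - a|^2] bounds [2 ip a b] by [|a|^2 + |b|^2], while the hypothesis bounds it
    below by [2 |a|^2]. *)
Lemma norm_le_ip (R : realType) (H : completeNormedModType R)
    (ip : {dot H for (@idfun R)}) (Hip : induces_norm ip) (a b : H) :
  ip a a <= ip a b -> `|a| <= `|b|.
Proof.
move=> leab; rewrite -(ler_pXn2r (ltn0Sn 1)) ?nnegrE// !Hip.
have : 0 <= ip (b - a) (b - a) by rewrite -Hip sqr_ge0.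
rewrite linearBl !linearBr/= (hermC ip b a)/= expr0 mul1r.
lra.
Qed.

Lemma resolvent_residual_le (R : realType) (H : completeNormedModType R)
    (ip : {dot H for (@idfun R)}) (Hip : induces_norm ip) (M : H -> set H)
    (y x z : H) : monotone_operator ip M ->
  resolvent M y x -> resolvent M x z -> `|z - x| <= `|x - y|.
Proof.
move=> Mmon /resolventP Mx /resolventP Mz; apply: (norm_le_ip Hip).
(* With [a = z - x] and [b = x - y], monotonicity becomes [0 <= ip a (b - a)]: firm nonexpansiveness
   of the resolvent. *)
have := Mmon _ _ _ _ Mz Mx.
have -> : x - z - (y - x) = (x - y) - (z - x) by rewrite !opprB addrC.
by rewrite linearBr/= subr_ge0.
Qed.

Lemma window_le (m : option nat) (k : nat) : (window m k <= k)%N.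
Proof. by case: m => [m|] //=; exact: geq_minr. Qed.

Lemma window_combB (R : realType) (H : completeNormedModType R)
    (x y : nat -> H) (mu k : nat) (gamma : 'rV[R]_mu.+1) :
  window_comb (fun i => x i - y i) k gamma =
  window_comb x k gamma - window_comb y k gamma.
Proof. by rewrite /window_comb -sumrB; apply: eq_bigr => i _; rewrite scalerBr. Qed.

Lemma resolvent_window_comb (R : realType) (H : completeNormedModType R)
    (M : H -> set H) (x y : nat -> H) (mu k : nat) (gamma : 'rV[R]_mu.+1) :
  linear_operator M -> (forall i, resolvent M (y i) (x i)) ->
  resolvent M (window_comb y k gamma) (window_comb x k gamma).
Proof.
(* In terms of [M], the points [x i] and the images [y i - x i] are combined with the same
   weights. *)
move=> Mlin Jyx; apply/resolventP; rewrite -window_combB.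
by apply: linear_operator_sum => // i; exact/resolventP.
Qed.

Lemma AA_argmin_le (R : realType) (H : completeNormedModType R)
    (r : nat -> H) (mu k : nat) (gamma : 'rV[R]_mu.+1) :
  (mu <= k)%N -> AA_argmin r k gamma -> `|window_comb r k gamma| <= `|r k|.
Proof.
move=> lemuk [_ gamma_min].
have sum_last (V : lmodType R) (F : 'I_mu.+1 -> V) :
    \sum_i (delta_mx 0 ord_max : 'rV[R]_mu.+1) 0 i *: F i = F ord_max.
  rewrite (bigD1 ord_max)//= big1 ?addr0 => [|i /negPf ne_i].
    by rewrite mxE !eqxx scale1r.
  by rewrite mxE ne_i andbF scale0r.
have affine_last : affine_weights (delta_mx 0 ord_max : 'rV[R]_mu.+1).
  rewrite /affine_weights -[RHS](sum_last R^o (fun=> 1)).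
  by apply: eq_bigr => i _; rewrite /GRing.scale/= mulr1.
(* The last window index [mu] stands for iterate [k - mu + mu], which is [k] because [mu <= k]. *)
have := gamma_min _ affine_last.
by rewrite {2}/window_comb sum_last subnK// ler_pXn2r ?nnegrE.
Qed.

Theorem corollary2p5 (R : realType) (H : completeNormedModType R)
  (ip : {dot H for (@idfun R)}) (Hip : induces_norm ip)
  (M : H -> set H) (Mlin : linear_operator M) (Mmax : maximal_monotone ip M)
  (m : option nat) (y0 : H) (x y r : nat -> H)
  (run : AA_run M m y0 x y r) :
  forall k : nat, `|r k.+1| <= `|r k|.
Proof.
case: run => _ Jyx rE y1E step k.
have rB : r = fun i => x i - y i by exact/funext.
(* This form covers both the unaccelerated first step and the later ones; [resolvent_residual_le]
   then compares [r k.+1] with [x' - y']. *)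
suff [x' [y' [Jyx' yE le_rk]]] : exists x' y',
    [/\ resolvent M y' x', y k.+1 = x' & `|x' - y'| <= `|r k|].
  rewrite {1}rE yE; apply: le_trans le_rk.
  by apply: (resolvent_residual_le Hip Mmax.1); [|rewrite -yE].
(* At [k = 0] nothing is minimized: [y 1 = x 0], so the initial pair itself works. *)
case: k => [|k]; first by exists (x 0%N), (y 0%N); rewrite rE.
have [gamma gamma_min yE] := step k.+1 isT.
exists (window_comb x k.+1 gamma), (window_comb y k.+1 gamma); split => //.
  exact: resolvent_window_comb.
by rewrite -window_combB -rB; exact: AA_argmin_le (window_le m k.+1) gamma_min.
Qed.
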